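(* Let $R$ be a unital ring with stable rank one. Let $P,Q,C,D$ be countably generated projective right $R$-modules such that $P\oplus C\precsim Q\oplus D$, with $D\subseteq C\subseteq R^n$ for some $n\in\mathbb{N}$, and such that $D\subseteq C$ has a complement in $R^n$. Then $P\precsim Q$.
   Context: A unital ring $R$ has stable rank one if for all $a,b\in R$ with $Ra+Rb=R$ there is $y\in R$ with $R(a+yb)=R$. For right $R$-modules $P,Q$, write $P\precsim Q$ if for every finitely generated submodule $X$ of $P$ there are module homomorphisms $\phi\colon X\to Q$ and $\psi\colon Q\to P$ such that $\psi\circ\phi$ is the inclusion $X\hookrightarrow P$. A submodule $N$ of a right $R$-module $M$ is pure if for every left $R$-module $X$ the map $N\otimes_R X\to M\otimes_R X$ induced by inclusion is injective. (When $M$ is projective this is equivalent to: for every finitely generated submodule $F\subseteq N$ there is a homomorphism $\sigma\colon M\to N$ with $\sigma|_F=\mathrm{id}_F$.) Complements: let $D\subseteq C\subseteq R^n$ be countably generated right $R$-modules. A complement of $D\subseteq C$ in $R^n$ is a countably generated submodule $E$ of $R^n$ such that $C+E=R^n$, $D\cap E=0$, and $D+E$ is a pure submodule of $R^n$. *)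

(* Defs.v *)
From HB Require Import structures.
From mathcomp Require Import all_boot all_algebra.
From mathcomp Require Import boolp.
From mathcomp Require Import freeg.

Set Implicit Arguments.
Unset Strict Implicit.
Unset Printing Implicit Defensive.

Import GRing.Theory.

Local Open Scope ring_scope.
Local Open Scope quotient_scope.

(* [lmodType R] is the type of left [R]-modules, so a right [R]-module is an
   [lmodType R^c], where [R^c] is the opposite ring: [m . r] is written
   [(r : R^c) *: m].  In particular the right module [R^n] is ['rV[R^c]_n],
   on which [r] acts by right multiplication of each coordinate.  Rings are
   [pzRingType]s, so that the zero ring is allowed. *)

Definition stable_rank_one (R : pzRingType) : Prop :=
  forall a b : R,
    (forall r : R, exists s t : R, r = s * a + t * b) ->
    exists y : R, forall r : R, exists s : R, r = s * (a + y * b).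

Section Submodules.
Variables (S : pzRingType) (V : lmodType S).

Definition submod (N : submodClosed V) := {x : V | x \in N}.

HB.instance Definition _ (N : submodClosed V) := SubChoice.on (submod N).
HB.instance Definition _ (N : submodClosed V) :=
  [SubChoice_isSubLmodule of submod N by <:].

Definition addsm (N1 N2 : submodClosed V) : {pred V} :=
  fun v => `[< exists x y : V, [/\ x \in N1, y \in N2 & v = x + y] >].

Fact addsm_submod_closed (N1 N2 : submodClosed V) :
  GRing.submod_closed (addsm N1 N2).
Proof.
split; first by apply/asboolP; exists 0, 0; rewrite !rpred0 addr0.
move=> a _ _ /asboolP[x1 [y1 [N1x1 N2y1 ->]]] /asboolP[x2 [y2 [N1x2 N2y2 ->]]].
apply/asboolP; exists (a *: x1 + x2), (a *: y1 + y2).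
by split; rewrite ?rpredD ?rpredZ // scalerDr addrACA.
Qed.

HB.instance Definition _ (N1 N2 : submodClosed V) :=
  GRing.isSubmodClosed.Build S V (addsm N1 N2) (addsm_submod_closed N1 N2).

End Submodules.

Section ModuleProperties.
Variable S : pzRingType.

Definition fin_generated (M : lmodType S) : Prop :=
  exists (k : nat) (g : 'I_k -> M), forall x : M,
  exists c : 'I_k -> S, x = \sum_(i < k) c i *: g i.

Definition countably_generated (M : lmodType S) : Prop :=
  exists g : nat -> M, forall x : M,
  exists (k : nat) (c : 'I_k -> S), x = \sum_(i < k) c i *: g i.

Definition projective (M : lmodType S) : Prop :=
  forall (A B : lmodType S) (p : {linear A -> B}) (f : {linear M -> B}),
    (forall b : B, exists a : A, p a = b) ->
    exists h : {linear M -> A}, forall x : M, p (h x) = f x.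

Definition precsim (P Q : lmodType S) : Prop :=
  forall X : submodClosed P, fin_generated (submod X) ->
  exists (phi : {linear submod X -> Q}) (psi : {linear Q -> P}),
  forall x : submod X, psi (phi x) = \val x.

End ModuleProperties.

(* The abelian group [M (x)_R X], for [M] a right and [X] a left [R]-module,
   is the free abelian group on [M * X] modulo the subgroup generated by the
   usual relations. *)
Section Tensor.
Variables (R : pzRingType) (M : lmodType R^c) (X : lmodType R).

Notation FMX := {freeg (M * X)%type / int}.

Inductive tensor_relation : FMX -> Prop :=
| TensorDl (m1 m2 : M) (x : X) :
    tensor_relation (<< (m1 + m2, x) >> - << (m1, x) >> - << (m2, x) >>)
| TensorDr (m : M) (x1 x2 : X) :
    tensor_relation (<< (m, x1 + x2) >> - << (m, x1) >> - << (m, x2) >>)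
| TensorM (m : M) (r : R) (x : X) :
    tensor_relation (<< ((r : R^c) *: m, x) >> - << (m, r *: x) >>)
| Tensor0 : tensor_relation 0
| TensorB u v :
    tensor_relation u -> tensor_relation v -> tensor_relation (u - v).

Definition tensor_relations : {pred FMX} := fun u => `[< tensor_relation u >].

Fact tensor_relations_zmod_closed : zmod_closed tensor_relations.
Proof.
split; first by apply/asboolP; exact: Tensor0.
by move=> u v /asboolP ? /asboolP ?; apply/asboolP; exact: TensorB.
Qed.

HB.instance Definition _ :=
  GRing.isZmodClosed.Build FMX tensor_relations tensor_relations_zmod_closed.

Definition tensor := {ideal_quot (tensor_relations : zmodClosed FMX)}.

Definition tens (m : M) (x : X) : tensor := \pi_tensor << (m, x) >>.

Fact tensor_piP (u v : FMX) :
  \pi_tensor u = \pi_tensor v <-> tensor_relation (u - v).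
Proof.
have E : (u - v \in tensor_relations) = (u == v %[mod tensor]) :=
  Quotient.idealrBE (tensor_relations : zmodClosed FMX) u v.
split=> [/eqP|H]; first by rewrite -E => /asboolP.
by apply/eqP; rewrite -E; apply/asboolP.
Qed.

Fact tensDl m1 m2 x : tens (m1 + m2) x = tens m1 x + tens m2 x.
Proof.
by rewrite /tens -raddfD; apply/tensor_piP; rewrite opprD addrA; exact: TensorDl.
Qed.

Fact tensDr m x1 x2 : tens m (x1 + x2) = tens m x1 + tens m x2.
Proof.
by rewrite /tens -raddfD; apply/tensor_piP; rewrite opprD addrA; exact: TensorDr.
Qed.

Fact tensM m (r : R) x : tens ((r : R^c) *: m) x = tens m (r *: x).
Proof. by apply/tensor_piP; exact: TensorM. Qed.

End Tensor.

(* [tensor_map X f] is [f (x)_R id_X]. *)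
Section TensorMap.
Variables (R : pzRingType) (M N : lmodType R^c) (X : lmodType R).
Variable f : {linear M -> N}.

Definition tensor_map_free :
    {freeg (M * X)%type / int} -> {freeg (N * X)%type / int} :=
  fglift (fun k => << (f k.1, k.2) >>).

Definition tensor_map (t : tensor M X) : tensor N X :=
  \pi_(tensor N X) (tensor_map_free (repr t)).

Fact tensor_map_pi u :
  tensor_map (\pi_(tensor M X) u) = \pi_(tensor N X) (tensor_map_free u).
Proof.
pose fB := lift_is_additive (fun k : M * X => << (f k.1, k.2) >>
  : {freeg (N * X)%type / int}).
have fU k : tensor_map_free << k >> = << (f k.1, k.2) >>.
  by rewrite /tensor_map_free liftU scale1r.
apply/tensor_piP; rewrite -fB -/tensor_map_free.
have: tensor_relation (repr (\pi_(tensor M X) u) - u).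
  by apply/tensor_piP; rewrite reprK.
elim=> [m1 m2 x|m x1 x2|m r x||v w _ IHv _ IHw].
- by rewrite /tensor_map_free !fB -/tensor_map_free !fU linearD; exact: TensorDl.
- by rewrite /tensor_map_free !fB -/tensor_map_free !fU; exact: TensorDr.
- by rewrite /tensor_map_free fB -/tensor_map_free !fU linearZ; exact: TensorM.
- by rewrite -(subrr 0) /tensor_map_free fB subrr; exact: Tensor0.
- by rewrite /tensor_map_free fB; exact: TensorB.
Qed.

Fact tensor_map_tens m x : tensor_map (tens m x) = tens (f m) x.
Proof. by rewrite /tens tensor_map_pi /tensor_map_free liftU scale1r. Qed.

Fact tensor_map_zmod_morphism : zmod_morphism tensor_map.
Proof.
move=> s t; rewrite -[s]reprK -[t]reprK -raddfB !tensor_map_pi -raddfB.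
by rewrite /tensor_map_free lift_is_additive.
Qed.

End TensorMap.

Arguments tensor_map {R M N} X f t.

Section PureComplement.
Variable R : pzRingType.

Definition pure (M : lmodType R^c) (N : submodClosed M) : Prop :=
  forall X : lmodType R,
    injective (tensor_map X (\val : {linear submod N -> M})).

(* [E] is a complement of [D <= C] in [R^n]; that [C] and [D] are countably
   generated with [D <= C] is assumed separately. *)
Definition is_complement (n : nat) (C D E : submodClosed 'rV[R^c]_n) : Prop :=
  [/\ countably_generated (submod E),
      forall v : 'rV[R^c]_n, v \in addsm C E,
      forall v : 'rV[R^c]_n, v \in D -> v \in E -> v = 0
    & pure (addsm D E)].

End PureComplement.

(* Main.v *)
Require Import Defs.
From mathcomp Require Import all_boot all_algebra.
From HB Require Import structures.
From mathcomp Require Import boolp freeg.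

(** Let [E] be a complement of [D] in [C] inside the free module [F] of rank
    [n].  Since [C + E = F] and [F] is free, the sum map from [C * E] onto [F]
    splits, so [F] is a direct summand of [C * E].  Since [D] and [E] meet
    trivially, [D * E] is isomorphic to [D + E], and purity of [D + E] in [F]
    makes it a local direct summand: [D * E] is below [F] for [precsim].  As
    [precsim] is a preorder compatible with products,
    [P * F <= P * C * E <= Q * D * E <= Q * F], and it remains to cancel [F].

    Cancellation ([precsim_cancel_free]) removes one rank at a time, by the
    argument of Evans.  Suppose that [phi : M * S -> Q * S], followed by
    [psi : Q * S -> P * S], is the product of a map [M -> P] and the identity
    of [S].  The image [(q, b)] under [phi] of the generator of [S] is
    unimodular: [psi], followed by the projection to [S], sends it to [1].
    Stable rank one provides an automorphism of [Q * S] that turns [b] into a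
    right invertible element, which is a unit because such rings are Dedekind
    finite; a second automorphism then turns [q] into [0], and the two blocks
    separate.

    Purity is defined by injectivity of tensor products, and is used through
    [pure_local_retraction]: finitely many elements [f j] of a pure submodule
    [N] of [F] are fixed by some linear map from [F] to [N].  With [A] the
    matrix of coordinates of the [f j], this asks to solve the linear system
    [f = y A] in [N], given that the standard basis solves it in [F].  The
    obstruction to a solution is the element [sum_j (f j) (x) x_j] of the
    tensor product of [N] with the cokernel of [A], where the [x_j] are the
    standard generators ([tens_eq0_solvable]); it vanishes over [F], hence
    over [N].

    The relation [precsim] is handled through [precsimP], where inclusions of
    finitely generated submodules are replaced by arbitrary linear maps from
    finitely generated modules: transitivity and products are then immediate. *)

Set Implicit Arguments.
Unset Strict Implicit.
Unset Printing Implicit Defensive.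

Import GRing.Theory.

Local Open Scope ring_scope.
Local Open Scope quotient_scope.

(** * Linear maps *)

Section LinearMaps.
Variable S : pzRingType.
Implicit Types U V W : lmodType S.

Definition mk_linear U V (f : U -> V) (lf : linear f) : {linear U -> V} :=
  HB.pack f (GRing.isLinear.Build S U V *:%R f lf).

Fact pair_linear U V W (f : {linear U -> V}) (g : {linear U -> W}) :
  linear (fun u => (f u, g u) : (V * W)%type).
Proof. by move=> a u v; rewrite !linearP. Qed.

Definition pair_map U V W (f : {linear U -> V}) (g : {linear U -> W}) :
  {linear U -> (V * W)%type} := mk_linear (pair_linear f g).

Fact prod_linear U V U' V' (f : {linear U -> V}) (g : {linear U' -> V'}) :
  linear (fun u => (f u.1, g u.2) : (V * V')%type).
Proof. by move=> a u v /=; rewrite !linearP. Qed.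

Definition prod_map U V U' V' (f : {linear U -> V}) (g : {linear U' -> V'}) :
  {linear (U * U')%type -> (V * V')%type} := mk_linear (prod_linear f g).

Fact combination_linear n V (w : 'I_n -> V) :
  linear (fun v : 'rV[S]_n => \sum_(i < n) v 0 i *: w i).
Proof.
move=> a u v; rewrite scaler_sumr -big_split; apply: eq_bigr => i _ /=.
by rewrite !mxE scalerDl scalerA.
Qed.

Definition combination n V (w : 'I_n -> V) : {linear 'rV[S]_n -> V} :=
  mk_linear (combination_linear w).

Fact sum_val_linear V (N1 N2 : submodClosed V) :
  linear (fun u : (submod N1 * submod N2)%type => val u.1 + val u.2).
Proof. by move=> a u v /=; rewrite scalerDr addrACA. Qed.

Definition sum_val V (N1 N2 : submodClosed V) :
  {linear (submod N1 * submod N2)%type -> V} :=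
  mk_linear (sum_val_linear (N2 := N2)).

Lemma linear_inverse U V (f : {linear U -> V}) :
  injective f -> (forall v, exists u, f u = v) ->
  exists g : {linear V -> U}, forall u, g (f u) = u.
Proof.
move=> f_inj /choice[g fgK].
have lg : linear g by move=> a u v; apply: f_inj; rewrite linearP !fgK.
by exists (mk_linear lg) => u; apply: f_inj; rewrite fgK.
Qed.

(** Freeness gives the splitting: a section is determined by choosing preimages
    of the standard basis. *)
Lemma linear_section_rV n V (f : {linear V -> 'rV[S]_n}) :
  (forall v, exists u, f u = v) ->
  exists s : {linear 'rV[S]_n -> V}, forall v, f (s v) = v.
Proof.
move=> f_surj; have /choice[w fw] : forall i, exists u, f u = delta_mx 0 i.
  by move=> i; apply: f_surj.
exists (combination w) => v; rewrite [RHS]row_sum_delta linear_sum.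
by apply: eq_bigr => i _; rewrite linearZ /= fw.
Qed.

Lemma eq_linear_generated U V k (gen : 'I_k -> U) (f g : {linear U -> V}) :
  (forall x, exists c : 'I_k -> S, x = \sum_(i < k) c i *: gen i) ->
  (forall i, f (gen i) = g (gen i)) -> f =1 g.
Proof.
move=> genP fg x; have [c ->] := genP x; rewrite !linear_sum.
by apply: eq_bigr => i _; rewrite !linearZ /= fg.
Qed.

Definition limage U V (f : {linear U -> V}) : {pred V} :=
  fun v => `[< exists u, v = f u >].

Fact limage_submod_closed U V (f : {linear U -> V}) :
  GRing.submod_closed (limage f).
Proof.
split; first by apply/asboolP; exists 0; rewrite linear0.
move=> a _ _ /asboolP[u ->] /asboolP[v ->]; apply/asboolP.
by exists (a *: u + v); rewrite linearP.
Qed.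

HB.instance Definition _ U V (f : {linear U -> V}) :=
  GRing.isSubmodClosed.Build S V (limage f) (limage_submod_closed f).

Lemma mem_limage U V (f : {linear U -> V}) u : f u \in limage f.
Proof. by apply/asboolP; exists u. Qed.

Fact corestrict_linear U V (f : {linear U -> V}) :
  linear (fun u => exist _ (f u) (mem_limage f u) : submod (limage f)).
Proof. by move=> a u v; apply: val_inj; rewrite /= linearP. Qed.

Definition corestrict U V (f : {linear U -> V}) :
  {linear U -> submod (limage f)} := mk_linear (corestrict_linear f).

Lemma corestrict_surj U V (f : {linear U -> V}) (y : submod (limage f)) :
  exists u, corestrict f u = y.
Proof.
by have /asboolP[u yE] := valP y; exists u; apply: val_inj; rewrite yE.
Qed.

Lemma fin_generated_surj U V (f : {linear U -> V}) :
  (forall v, exists u, f u = v) -> fin_generated U -> fin_generated V.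
Proof.
move=> f_surj [k [gen genP]]; exists k, (fun i => f (gen i)) => v.
have [u <-] := f_surj v; have [c ->] := genP u; exists c.
by rewrite linear_sum; apply: eq_bigr => i _; rewrite linearZ.
Qed.

Lemma fin_generated_add_free U :
  fin_generated U -> fin_generated (U * S^o)%type.
Proof.
move=> [k [gen genP]].
exists k.+1, (fun i => if unlift ord0 i is Some j then (gen j, 0) else (0, 1)).
move=> [u s]; have [c ->] := genP u.
exists (fun i => if unlift ord0 i is Some j then c j else s).
rewrite big_ord_recl unlift_none.
rewrite (eq_bigr (fun j => c j *: (gen j, 0))) => [|j _]; last by rewrite liftK.
have -> : \sum_(i < k) c i *: ((gen i, 0) : (U * S^o)%type)
        = (\sum_(i < k) c i *: gen i, 0).
  elim/big_rec2: _ => // i x _ _ ->.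
  by congr pair; rewrite /= scaler0 addr0.
by congr pair; rewrite /= ?scaler0 ?add0r ?addr0 // [_ *: _]mulr1.
Qed.

End LinearMaps.

Arguments mk_linear {S U V f} lf.

(** * The relation of local direct summands *)

Section Precsim.
Variable S : pzRingType.
Implicit Types P Q M : lmodType S.

(** A map [i] from [M] can be replaced by the inclusion of its image, which is
    again finitely generated, so nothing is gained by requiring [i] to be
    injective. *)
Lemma precsimP P Q :
  precsim P Q <->
  forall M, fin_generated M -> forall i : {linear M -> P},
  exists (phi : {linear M -> Q}) (psi : {linear Q -> P}),
  forall x, psi (phi x) = i x.
Proof.
split=> [PQ M fgM i|PQ X fgX]; last exact: PQ fgX \val.
have [|phi [psi psiK]] := PQ (limage i).
  exact: fin_generated_surj (@corestrict_surj _ _ _ i) fgM.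
by exists (phi \o corestrict i), psi => x; rewrite /= psiK.
Qed.

Lemma precsim_trans P Q M : precsim P Q -> precsim Q M -> precsim P M.
Proof.
move=> /precsimP PQ /precsimP QM; apply/precsimP => N fgN i.
have [phi [psi psiK]] := PQ _ fgN i.
have [phi' [psi' psiK']] := QM _ fgN phi.
by exists phi', (psi \o psi') => x; rewrite /= psiK' psiK.
Qed.

Lemma precsim_retract P Q (f : {linear P -> Q}) (g : {linear Q -> P}) :
  cancel f g -> precsim P Q.
Proof.
by move=> fK; apply/precsimP => M _ i; exists (f \o i), g => x; rewrite /= fK.
Qed.

Lemma precsim_prod P P' Q Q' :
  precsim P Q -> precsim P' Q' -> precsim (P * P')%type (Q * Q')%type.
Proof.
move=> /precsimP PQ /precsimP PQ'; apply/precsimP => M fgM i.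
have [phi [psi psiK]] := PQ M fgM (fst \o i).
have [phi' [psi' psiK']] := PQ' M fgM (snd \o i).
exists (pair_map phi phi'), (prod_map psi psi') => x /=.
by rewrite psiK psiK' /=; case: (i x).
Qed.

Lemma precsim_refl P : precsim P P.
Proof. exact: (@precsim_retract _ _ idfun idfun). Qed.

Lemma precsim_prodA P Q M : precsim (P * (Q * M))%type (P * Q * M)%type.
Proof.
apply: (@precsim_retract _ _
  (pair_map (pair_map fst (fst \o snd)) (snd \o snd))
  (pair_map (fst \o fst) (pair_map (snd \o fst) snd))).
by move=> [p [q m]].
Qed.

Lemma precsim_prodAr P Q M : precsim (P * Q * M)%type (P * (Q * M))%type.
Proof.
apply: (@precsim_retract _ _
  (pair_map (fst \o fst) (pair_map (snd \o fst) snd))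
  (pair_map (pair_map fst (fst \o snd)) (snd \o snd))).
by move=> [[p q] m].
Qed.

End Precsim.

Arguments precsim_refl {S} P.
Arguments precsim_prodA {S} P Q M.
Arguments precsim_prodAr {S} P Q M.

(** * Cancellation under stable rank one *)

Section Cancellation.
Variable S : pzRingType.
Implicit Types P Q M : lmodType S.

(** Stable rank one, for right ideals and in terms of elements: right
    [R]-modules are left modules over the opposite ring [S] of [R], and the
    condition on left ideals of [R] becomes this one on [S]. *)
Definition unimodular_shortening : Prop :=
  forall a b s t : S, a * s + b * t = 1 -> exists y z : S, (a + b * y) * z = 1.

(** If [u * z = 1], the right ideals generated by [z] and by the idempotent
    [1 - z * u] sum to the whole ring.  The element [v] obtained by shortening
    is right invertible, and [u] is a left inverse of it since [u] kills
    [1 - z * u]; so [u] is a two-sided inverse of [v], and [z], being a right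
    inverse of [u], equals [v]. *)
Lemma shortening_dedekind_finite :
  unimodular_shortening -> forall u z : S, u * z = 1 -> z * u = 1.
Proof.
move=> sr u z uz1.
have [|y [w ew]] := sr z (1 - z * u) u 1; first by rewrite mulr1 addrC subrK.
set v := z + _ in ew; have uv1 : u * v = 1.
  by rewrite mulrDr mulrA mulrBr mulr1 mulrA uz1 mul1r subrr mul0r addr0.
have wu : w = u by rewrite -[w]mul1r -uv1 -mulrA ew mulr1.
rewrite wu in ew; suff <- : v = z by [].
by rewrite -[v]mulr1 -uz1 mulrA ew mul1r.
Qed.

(** Write [psi] and [phi] as block matrices, with entries [f, g, p, c] and
    [h, k, q, b].  Let [z] be the inverse of [b + g q * y].  Composing [phi]
    with [(q', s) |-> (q', s + g q' * y)] and then with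
    [(q', s) |-> (q' - (s * z) *: q, s)], and [psi] with their inverses, makes
    the image of the generator of the free summand equal to
    [(0, b + g q * y)].  The final witnesses are the corner blocks of these
    two composites; the other blocks do not contribute, since the new map from
    [Q * S] to [P * S] sends [(0, b + g q * y)] into the free summand. *)
Lemma precsim_cancel_free1 P Q :
  unimodular_shortening ->
  precsim (P * S^o)%type (Q * S^o)%type -> precsim P Q.
Proof.
move=> sr /precsimP PQ; apply/precsimP => M fgM i.
have [phi [psi psiK]] :=
  PQ _ (fin_generated_add_free fgM) (prod_map i (idfun : {linear S^o -> S^o})).
pose inP : {linear M -> (M * S^o)%type} := pair_map idfun \0.
pose inQ : {linear Q -> (Q * S^o)%type} := pair_map idfun \0.
pose h : {linear M -> Q} := fst \o (phi \o inP).
pose k : {linear M -> S^o} := snd \o (phi \o inP).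
pose f : {linear Q -> P} := fst \o (psi \o inQ).
pose g : {linear Q -> S^o} := snd \o (psi \o inQ).
pose q := (phi (0, 1)).1; pose b : S := (phi (0, 1)).2.
pose p := (psi (0, 1)).1; pose c : S := (psi (0, 1)).2.
have psiE w : psi w = (f w.1 + (w.2 : S) *: p, (g w.1 : S) + (w.2 : S) * c).
  rewrite {1}(_ : w = inQ w.1 + (w.2 : S) *: ((0, 1) : (Q * S^o)%type)).
    by rewrite linearD linearZ.
  case: w => q' r; congr pair; rewrite /= ?scaler0 ?addr0 ?add0r //.
  by rewrite [_ *: _]mulr1.
have fh x : f (h x) + (k x : S) *: p = i x.
  by have := congr1 fst (psiK (inP x)); rewrite psiE.
have fq : f q + b *: p = 0.
  by have := congr1 fst (psiK (0, 1)); rewrite psiE /= linear0.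
have gq : (g q : S) + b * c = 1.
  by have := congr1 snd (psiK (0, 1)); rewrite psiE.
(* With their bodies, the blocks would be unfolded by linearity rewriting. *)
clear psiE psiK; clearbody h k f g q b p c.
have [|y [z uz]] := sr b (g q) c 1; first by rewrite mulr1 addrC.
have zu := shortening_dedekind_finite sr uz.
pose r x : S := (k x + (g (h x) : S) * y) * z.
have phi_linear : linear (fun x => h x - r x *: q).
  move=> a x x'; rewrite /r !linearP /=.
  rewrite -[_ *: k x]/(a * _) -[_ *: g (h x)]/(a * _).
  rewrite [(_ + _) * y]mulrDl -[a * _ * y]mulrA addrACA -mulrDr.
  rewrite mulrDl -[a * _ * z]mulrA scalerDl opprD addrACA.
  by rewrite scalerBr scalerA.
have psi_linear : linear (fun q' => f q' - ((g q' : S) * y) *: p).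
  move=> a x x'; rewrite !linearP /= -[_ *: g x]/(a * _).
  rewrite mulrDl -mulrA scalerDl opprD addrACA.
  by rewrite scalerBr scalerA.
exists (mk_linear phi_linear), (mk_linear psi_linear) => x /=.
have -> : f (h x - r x *: q) = f (h x) - r x *: f q by rewrite linearB linearZ.
have -> : g (h x - r x *: q) = (g (h x) : S) - r x * (g q : S).
  by rewrite linearB linearZ.
have -> : f q = - (b *: p) by apply/eqP; rewrite -addr_eq0 fq.
rewrite -[RHS]fh -addrA; congr (_ + _).
have rE : r x * b + r x * (g q : S) * y = (k x : S) + (g (h x) : S) * y.
  by rewrite -[r x * _ * y]mulrA -mulrDr /r -mulrA zu mulr1.
rewrite scalerN opprK mulrBl scalerBl opprB scalerA addrA -scalerDl rE.
by rewrite scalerDl addrK.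
Qed.

Lemma precsim_cancel_free n P Q :
  unimodular_shortening ->
  precsim (P * 'rV[S]_n)%type (Q * 'rV[S]_n)%type -> precsim P Q.
Proof.
move=> sr; elim: n => [|n IHn] PQ.
  apply: (precsim_trans _ (precsim_trans PQ _)).
    exact: (@precsim_retract _ _ _ (pair_map idfun \0) fst).
  apply: (@precsim_retract _ _ _ fst (pair_map idfun \0)) => -[q v].
  by congr pair; apply/rowP; case.
have split_linear : linear (fun v : 'rV[S]_(1 + n) =>
    (rsubmx v, v 0 0) : ('rV[S]_n * S^o)%type).
  by move=> a u v; rewrite linearP !mxE.
have join_linear : linear (fun w : ('rV[S]_n * S^o)%type =>
    row_mx (w.2%:M) w.1 : 'rV[S]_(1 + n)).
  move=> a u v; rewrite scale_row_mx add_row_mx; congr row_mx.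
  by apply/matrixP => i j; rewrite !mxE !ord1 eqxx.
have splitK : cancel (mk_linear split_linear) (mk_linear join_linear).
  move=> v; rewrite /= -[RHS]hsubmxK; congr row_mx.
  apply/matrixP => i j; rewrite !mxE !ord1 eqxx mulr1n.
  by congr (v _ _); apply: val_inj.
have joinK : cancel (mk_linear join_linear) (mk_linear split_linear).
  move=> [v s] /=; congr pair; first by rewrite row_mxKr.
  rewrite (_ : 0 = lshift n (0 : 'I_1)) ?row_mxEl ?mxE //.
  exact: val_inj.
apply/IHn/(precsim_cancel_free1 sr).
apply: (precsim_trans (precsim_prodAr P 'rV[S]_n S^o)).
apply: (precsim_trans (precsim_trans _ PQ)).
  by apply: precsim_prod (precsim_refl _) (precsim_retract joinK).
apply: (precsim_trans _ (precsim_prodA Q 'rV[S]_n S^o)).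
by apply: precsim_prod (precsim_refl _) (precsim_retract splitK).
Qed.

End Cancellation.

(** * Pure submodules of free modules *)

Section Quotient.
Variables (R : pzRingType) (V : lmodType R) (N : submodClosed V).

(** Closure under opposites is not part of the structure of [submodClosed]; it
    comes from scaling by [-1], and is what the additive quotient requires. *)
Fact submod_zmod_closed : zmod_closed N.
Proof.
split=> [|u v Nu Nv]; first exact: rpred0.
by rewrite rpredD // -scaleN1r rpredZ.
Qed.

Definition zmod_of_submod : zmodClosed V :=
  HB.pack (fun v => v \in N)
    (GRing.isZmodClosed.Build V (fun v => v \in N) submod_zmod_closed).

Definition quotmod := {ideal_quot zmod_of_submod}.

HB.instance Definition _ := GRing.Zmodule.on quotmod.

Lemma quotmod_eqP (u v : V) :
  reflect (\pi_quotmod u = \pi_quotmod v) (u - v \in N).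
Proof. by rewrite (Quotient.idealrBE zmod_of_submod); apply: eqP. Qed.

Definition quotmod_scale (a : R) (x : quotmod) : quotmod :=
  \pi_quotmod (a *: repr x).

Lemma quotmod_scale_pi a v :
  quotmod_scale a (\pi_quotmod v) = \pi_quotmod (a *: v).
Proof.
apply/quotmod_eqP; rewrite -scalerBr rpredZ //.
by apply/quotmod_eqP; rewrite reprK.
Qed.

Fact quotmod_scalerA a b x :
  quotmod_scale a (quotmod_scale b x) = quotmod_scale (a * b) x.
Proof. by rewrite quotmod_scale_pi scalerA. Qed.

Fact quotmod_scale1r : left_id 1 quotmod_scale.
Proof. by move=> x; rewrite /quotmod_scale scale1r reprK. Qed.

Fact quotmod_scalerDr : right_distributive quotmod_scale +%R.
Proof.
move=> a x y; rewrite -[x]reprK -[y]reprK -raddfD !quotmod_scale_pi.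
by rewrite scalerDr raddfD.
Qed.

Fact quotmod_scalerDl x : {morph quotmod_scale^~ x : a b / a + b}.
Proof. by move=> a b; rewrite /quotmod_scale scalerDl raddfD. Qed.

HB.instance Definition _ := GRing.Zmodule_isLmodule.Build R quotmod
  quotmod_scalerA quotmod_scale1r quotmod_scalerDr quotmod_scalerDl.

Lemma quotmod_pi_scale a v :
  \pi_quotmod (a *: v) = a *: (\pi_quotmod v : quotmod).
Proof. by rewrite -quotmod_scale_pi. Qed.

End Quotient.

Section TensorSums.
Variables (R : pzRingType) (M : lmodType R^c) (X : lmodType R).

Lemma tens0r (m : M) : tens m (0 : X) = 0.
Proof. by apply: (addrI (tens m 0)); rewrite -tensDr !addr0. Qed.

Lemma tens0l (x : X) : tens (0 : M) x = 0.
Proof. by apply: (addrI (tens 0 x)); rewrite -tensDl !addr0. Qed.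

Lemma tens_suml I (r : seq I) (m : I -> M) (x : X) :
  tens (\sum_(i <- r) m i) x = \sum_(i <- r) tens (m i) x.
Proof.
by apply: (big_morph (fun y => tens y x)) => [? ?|]; rewrite ?tensDl ?tens0l.
Qed.

Lemma tens_sumr I (r : seq I) (m : M) (x : I -> X) :
  tens m (\sum_(i <- r) x i) = \sum_(i <- r) tens m (x i).
Proof. by apply: (big_morph (tens m)) => [? ?|]; rewrite ?tensDr ?tens0r. Qed.

End TensorSums.

HB.instance Definition _ (R : pzRingType) (M N : lmodType R^c) (X : lmodType R)
    (f : {linear M -> N}) :=
  GRing.isZmodMorphism.Build _ _ (tensor_map X f)
    (tensor_map_zmod_morphism (X := X) f).

Section Pure.
Variables (R : pzRingType) (n k : nat) (A : 'M[R]_(n, k)).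

Definition row_span : {pred 'rV[R]_k} := fun v => `[< exists w, v = w *m A >].

Fact row_span_submod_closed : GRing.submod_closed row_span.
Proof.
split; first by apply/asboolP; exists 0; rewrite mul0mx.
move=> a _ _ /asboolP[u ->] /asboolP[v ->]; apply/asboolP.
by exists (a *: u + v); rewrite mulmxDl scalemxAl.
Qed.

HB.instance Definition _ :=
  GRing.isSubmodClosed.Build R 'rV[R]_k row_span row_span_submod_closed.

(** The left module presented by [A]: the generators are indexed by the
    columns and the relations are the rows. *)
Notation X := (quotmod row_span).

Definition cokernel_gen (j : 'I_k) : X := \pi_X (delta_mx 0 j).

Lemma cokernel_rel i : \sum_(j < k) A i j *: cokernel_gen j = 0.
Proof.
under eq_bigr do rewrite -quotmod_pi_scale.
rewrite -raddf_sum -[RHS](raddf0 \pi_X); apply/quotmod_eqP; rewrite subr0.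
apply/asboolP; exists (delta_mx 0 i); rewrite -rowE.
by rewrite [RHS]row_sum_delta; apply: eq_bigr => j _; rewrite mxE.
Qed.

Variable N : lmodType R^c.

(** The image of the map from [N ^ n] to [N ^ k] given by [A].  The quotient of
    [N ^ k] by it is the tensor product of [N] with [X], so membership is an
    invariant of tensor relations. *)
Definition solvable_rhs (f : 'I_k -> N) : Prop :=
  exists y : 'I_n -> N, forall j, f j = \sum_(i < n) (A i j : R^c) *: y i.

Lemma solvable_rhsB f g :
  solvable_rhs f -> solvable_rhs g -> solvable_rhs (fun j => f j - g j).
Proof.
move=> [y fy] [z gz]; exists (fun i => y i - z i) => j.
by rewrite fy gz -sumrB; apply: eq_bigr => i _; rewrite scalerBr.
Qed.

Lemma solvable_rhs_sum m (g : 'I_m -> 'I_k -> N) :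
  (forall l, solvable_rhs (g l)) ->
  solvable_rhs (fun j => \sum_(l < m) g l j).
Proof.
move=> /choice[y gy]; exists (fun i => \sum_(l < m) y l i) => j.
under eq_bigr do rewrite gy.
by rewrite exchange_big; apply: eq_bigr => i _; rewrite scaler_sumr.
Qed.

Lemma solvable_rhs_row (v : 'rV[R]_k) (m : N) :
  v \in row_span -> solvable_rhs (fun j => (v 0 j : R^c) *: m).
Proof.
move=> /asboolP[w ->]; exists (fun i => (w 0 i : R^c) *: m) => j.
by rewrite mxE scaler_suml; apply: eq_bigr => i _; rewrite scalerA.
Qed.

(** The map from the tensor product to [N ^ k] modulo [solvable_rhs], on pairs:
    [x] is replaced by some representative in the free module.  Additivity and
    linearity in [x] thus hold only up to [solvable_rhs].  The codomain is a
    [zmodule] because [fglift] takes values in modules over [int]. *)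
Definition rhs_of_pair (mx : (N * X)%type) : zmodule {ffun 'I_k -> N} :=
  [ffun j => (repr mx.2 0 j : R^c) *: mx.1].

Definition rhs_of_free :
    {freeg (N * X)%type / int} -> zmodule {ffun 'I_k -> N} :=
  fglift rhs_of_pair.

Lemma rhs_of_freeU m x :
  rhs_of_free << (m, x) >> = [ffun j => (repr x 0 j : R^c) *: m].
Proof. by rewrite /rhs_of_free liftU scale1r. Qed.

Lemma rhs_of_freeB u v : rhs_of_free (u - v) = rhs_of_free u - rhs_of_free v.
Proof. exact: lift_is_additive. Qed.

HB.instance Definition _ :=
  GRing.isZmodMorphism.Build _ _ rhs_of_free rhs_of_freeB.

Lemma eq_solvable_rhs f g : f =1 g -> solvable_rhs f -> solvable_rhs g.
Proof. by move=> fg [y fy]; exists y => j; rewrite -fg. Qed.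

Lemma solvable_rhs_repr (x : X) (v : 'rV[R]_k) (m : N) :
  x = \pi_X v ->
  solvable_rhs (fun j => (repr x 0 j : R^c) *: m - (v 0 j : R^c) *: m).
Proof.
move=> xv; have: repr x - v \in row_span by apply/quotmod_eqP; rewrite reprK.
move/(solvable_rhs_row m); apply: eq_solvable_rhs => j.
by rewrite !mxE scalerBl.
Qed.

(** Additivity in [m] is exact; the other two generating relations change the
    representative of [x] by a combination of rows of [A]. *)
Lemma tensor_relation_solvable u :
  tensor_relation u -> solvable_rhs (rhs_of_free u : {ffun 'I_k -> N}).
Proof.
elim=> [m1 m2 x|m x1 x2|m r x||v w _ IHv _ IHw].
- exists (fun=> 0) => j; rewrite !rhs_of_freeB !rhs_of_freeU !ffunE scalerDr.
  by rewrite addrAC addrK subrr big1 // => i _; rewrite scaler0.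
- have /(solvable_rhs_repr m) : x1 + x2 = \pi_X (repr x1 + repr x2).
    by rewrite raddfD /= !reprK.
  apply: eq_solvable_rhs => j; rewrite !rhs_of_freeB !rhs_of_freeU !ffunE mxE.
  by rewrite scalerDl opprD addrA.
- have /(solvable_rhs_repr m) : r *: x = \pi_X (r *: repr x).
    by rewrite quotmod_pi_scale reprK.
  move/(solvable_rhsB (f := fun=> 0)); case.
    by exists (fun=> 0) => j; rewrite big1 // => i _; rewrite scaler0.
  move=> y fy; exists y => j; rewrite -fy.
  by rewrite !rhs_of_freeB !rhs_of_freeU !ffunE mxE scalerA sub0r opprB.
- exists (fun=> 0) => j; rewrite -(subrr 0) rhs_of_freeB subrr !ffunE.
  by rewrite big1 // => i _; rewrite scaler0.
- apply: eq_solvable_rhs (solvable_rhsB IHv IHw) => j.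
  by rewrite rhs_of_freeB !ffunE.
Qed.

(** The vector [f] is the image of the tensor, up to [solvable_rhs]: if the
    chosen representative of the [j]-th generator were the [j]-th basis
    vector, the image would be [f] itself. *)
Lemma tens_eq0_solvable (f : 'I_k -> N) :
  \sum_(j < k) tens (f j) (cokernel_gen j) = 0 -> solvable_rhs f.
Proof.
rewrite /tens -raddf_sum -(raddf0 \pi_(tensor N X)) => /tensor_piP.
rewrite subr0 => /tensor_relation_solvable sol.
have {}sol : solvable_rhs
    (fun j => \sum_(l < k) (repr (cokernel_gen l) 0 j : R^c) *: f l).
  apply: eq_solvable_rhs sol => j; rewrite raddf_sum sum_ffunE.
  by apply: eq_bigr => l _; rewrite /= rhs_of_freeU ffunE.
have err : solvable_rhs (fun j => \sum_(l < k)
    ((repr (cokernel_gen l) 0 j : R^c) *: f l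
     - ((delta_mx 0 l : 'rV[R]_k) 0 j : R^c) *: f l)).
  by apply: solvable_rhs_sum => l; apply: solvable_rhs_repr.
apply: eq_solvable_rhs (solvable_rhsB sol err) => j.
rewrite sumrB opprB addrC subrK (bigD1 j) //= mxE !eqxx scale1r.
rewrite big1 ?addr0 // => l /negPf lj.
by rewrite mxE eqxx eq_sym lj scale0r.
Qed.

End Pure.

(** In the free module, [f j] is the combination of the standard basis with
    coefficients [A i j]; moving these across the tensor sign exhibits the
    relations of the cokernel.  So the obstruction to solving the same system
    in [N] dies in the free module, and by purity it is [0].  A solution [y]
    defines [sigma], which sends the [i]-th basis vector to [y i]. *)
Lemma pure_local_retraction (R : pzRingType) n (N : submodClosed 'rV[R^c]_n)
    k (f : 'I_k -> submod N) :
  pure N ->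
  exists sigma : {linear 'rV[R^c]_n -> submod N},
  forall j, sigma (val (f j)) = f j.
Proof.
move=> pureN.
pose A : 'M[R]_(n, k) := \matrix_(i, j) (val (f j) 0 i : R).
have [y fy] : solvable_rhs A f.
  apply: tens_eq0_solvable; apply: pureN.
  rewrite raddf0 raddf_sum.
  transitivity (\sum_(j < k) \sum_(i < n)
      tens (delta_mx 0 i : 'rV[R^c]_n) (A i j *: cokernel_gen A j)).
    apply: eq_bigr => j _; rewrite /= tensor_map_tens.
    rewrite -[LHS]/(tens (val (f j)) _).
    rewrite {1}[val (f j)]row_sum_delta tens_suml.
    by apply: eq_bigr => i _; rewrite mxE -tensM.
  rewrite exchange_big big1 //= => i _; rewrite -tens_sumr.
  by rewrite cokernel_rel tens0r.
exists (combination y) => j; rewrite [RHS]fy /=.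
by apply: eq_bigr => i _; rewrite mxE.
Qed.

Lemma precsim_pure (R : pzRingType) n (N : submodClosed 'rV[R^c]_n) :
  pure N -> precsim (submod N) 'rV[R^c]_n.
Proof.
move=> pureN; apply/precsimP => M [k [gen genP]] i.
have [sigma sigmaK] := pure_local_retraction (fun j => i (gen j)) pureN.
exists (\val \o i), sigma => x.
exact: (eq_linear_generated genP (f := sigma \o (\val \o i))).
Qed.

(** * Cancelling complemented submodules *)

(** A left ideal is the whole ring as soon as it contains [1], and products are
    reversed in the opposite ring. *)
Lemma stable_rank_one_shortening (R : pzRingType) :
  stable_rank_one R -> unimodular_shortening R^c.
Proof.
move=> sr a b s t abst; have [|y yP] := sr a b.
  move=> r; exists ((r : R) * (s : R)), ((r : R) * (t : R)).
  by rewrite -!mulrA -mulrDr [X in r * X]abst mulr1.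
by have [z zP] := yP 1; exists y, z.
Qed.

Lemma addsm_iso (S : pzRingType) (V : lmodType S) (D E : submodClosed V) :
  (forall v, v \in D -> v \in E -> v = 0) ->
  precsim (submod D * submod E)%type (submod (addsm D E)).
Proof.
move=> DE0.
have sum_in (u : (submod D * submod E)%type) : sum_val D E u \in addsm D E.
  by apply/asboolP; exists (val u.1), (val u.2); split=> //; exact: valP.
have lf : linear (fun u => exist _ (sum_val D E u) (sum_in u)
    : submod (addsm D E)).
  by move=> a u v; apply: val_inj; exact: (linearP (sum_val D E)).
have [||g gK] := @linear_inverse _ _ _ (mk_linear lf); last first.
- exact: precsim_retract gK.
- case=> v Pv; have /asboolP[x [y [Dx Ey vE]]] := Pv.
  by exists (exist _ x Dx, exist _ y Ey); apply: val_inj; rewrite /= vE.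
- move=> [x y] [x' y'] /(congr1 val) /= eq_sum.
  have xy : val x - val x' = val y' - val y.
    by apply/eqP; rewrite subr_eq addrAC [_ + val x']addrC -eq_sum addrK.
  have x0 : val x - val x' = 0.
    apply: DE0; first exact: (valP (x - x')).
    by rewrite xy; exact: (valP (y' - y)).
  congr pair; apply: val_inj; apply/eqP; first by rewrite -subr_eq0 x0.
  by rewrite eq_sym -subr_eq0 -xy x0.
Qed.

Theorem theorem4 (R : pzRingType) (P Q : lmodType R^c) (n : nat)
    (C D : submodClosed 'rV[R^c]_n)
    (srR : stable_rank_one R)
    (cgP : countably_generated P) (projP : projective P)
    (cgQ : countably_generated Q) (projQ : projective Q)
    (cgC : countably_generated (submod C)) (projC : projective (submod C))
    (cgD : countably_generated (submod D)) (projD : projective (submod D))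
    (PCQD : precsim (P * submod C)%type (Q * submod D)%type)
    (DC : {subset D <= C})
    (complDC : exists E : submodClosed 'rV[R^c]_n, is_complement C D E) :
  precsim P Q.
Proof.
have [E [_ CE DE0 pureDE]] := complDC.
have free_CE : precsim 'rV[R^c]_n (submod C * submod E)%type.
  have [v|s sK] := @linear_section_rV _ _ _ (sum_val C E).
    have /asboolP[x [y [Cx Ey ->]]] := CE v.
    by exists (exist _ x Cx, exist _ y Ey).
  exact: precsim_retract sK.
have DE_free : precsim (submod D * submod E)%type 'rV[R^c]_n.
  exact: precsim_trans (addsm_iso DE0) (precsim_pure pureDE).
apply: precsim_cancel_free (stable_rank_one_shortening srR) _.
apply: precsim_trans (precsim_prod (precsim_refl P) free_CE) _.
apply: precsim_trans (precsim_prodA P (submod C) (submod E)) _.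
apply: precsim_trans (precsim_prod PCQD (precsim_refl (submod E))) _.
apply: precsim_trans (precsim_prodAr Q (submod D) (submod E)) _.
exact: precsim_prod (precsim_refl Q) DE_free.
Qed.
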